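(* Let $L$ and $L'$ be (oriented, possibly virtual) links. Then the quandles $Q_{\mathrm{tc}}(L)$ and $Q_{\mathrm{tc}}(L')$ are isomorphic if and only if both of the following requirements are satisfied. (a) $L$ and $L'$ have the same number of components. (b) The components of $L$ and $L'$ can be indexed so that $L=K_1\cup\dots\cup K_\mu$, $L'=K'_1\cup\dots\cup K'_\mu$, and there are $\epsilon_1,\dots,\epsilon_\mu\in\{-1,1\}$ such that $\ell_{j/i}(K_i,K_j)=\epsilon_i\,\ell_{j/i}(K'_i,K'_j)$ for all $i\neq j\in\{1,\dots,\mu\}$.
   Context: Quandles. A quandle is a set $Q$ with a binary operation $\triangleright$ such that: $x\triangleright x=x$ for all $x$; for each $y\in Q$ the map $\beta_y(x)=x\triangleright y$ is a bijection $Q\to Q$ (a translation); and $(w\triangleright x)\triangleright y=(w\triangleright y)\triangleright(x\triangleright y)$ for all $w,x,y$. A quandle map is a function $f$ with $f(x\triangleright y)=f(x)\triangleright f(y)$; a bijective quandle map is an isomorphism. A quandle is translation-commutative if the group generated by its translations is commutative, equivalently $(x\triangleright y)\triangleright z=(x\triangleright z)\triangleright y$ for all $x,y,z$. The translation-commutative quotient $Q_{\mathrm{tc}}$ of a quandle $Q$ is the quandle presented by a generator $x_q$ for each $q\in Q$, relations $x_{p\triangleright q}=x_p\triangleright x_q$ for all $p,q\in Q$, and relations $(x_p\triangleright x_q)\triangleright x_r=(x_p\triangleright x_r)\triangleright x_q$ for all $p,q,r\in Q$. Links. A link diagram $D$ is an oriented virtual link diagram in $\mathbb R^2$: it is obtained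 from a finite union of $\mu$ oriented piecewise smooth closed curves in general position (finitely many, transverse, double-point intersections and self-intersections, called crossings), each crossing being designated classical (with over/under information) or virtual. At each classical crossing a short piece of the underpassing segment is removed on each side of the crossing; virtual crossings are circled and nothing is removed there. This cuts the curves into arcs; $A(D)$ is the set of arcs. Two diagrams are equivalent if related by a finite sequence of detour moves (affecting only virtual crossings) and classical Reidemeister moves; an equivalence class is an (oriented, virtual) link $L=K_1\cup\dots\cup K_\mu$ with components $K_i$ given by the closed curves. Writhe. At a classical crossing $c$, the writhe $w(c)$ is $+1$ if, looking along the direction of the overpassing segment, the underpassing segment crosses from right to left, and $-1$ if it crosses from left to right. For $i\ne j$, let $C_{j/i}(D)$ be the set of classical crossings at which $K_j$ passes over $K_i$; the linking number of $K_j$ over $K_i$ is $\ell_{j/i}(K_i,K_j)=\ell_{j/i}(K_j,K_i)=\sum_{c\in C_{j/i}(D)}w(c)$, a link invariant. Link quandle. If $D$ is a diagram of $L$, $Q(L)$ is the quandle generated by $\{q_a\mid a\in A(D)\}$ subject to the relation $q_{a_3}=q_{a_2}\triangleright q_{a_1}$ at each classical crossing, where $a_1$ is the overpassing arc, and $a_2$ (resp. $a_3$) is the underpassing arc on the right (resp. left) of $a_1$ with respect to the orientation of $a_1$. It is a link invariant up to isomorphism. $Q_{\mathrm{tc}}(L)$ denotes $Q(L)_{\mathrm{tc}}$. *)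

(* Defs.v *)
(* MathComp-Analysis; quotients of arbitrary types are taken classically. *)
From HB Require Import structures.
From mathcomp Require Import all_boot all_order all_algebra.
From mathcomp Require Import generic_quotient.
From mathcomp Require Import all_classical all_reals all_analysis.
Set Implicit Arguments.
Unset Strict Implicit.
Unset Printing Implicit Defensive.
Import Order.TTheory GRing.Theory Num.Theory.
Import numFieldNormedType.Exports.
Local Open Scope classical_set_scope.
Local Open Scope ring_scope.
Local Open Scope quotient_scope.

(** * Quandles *)

Reserved Notation "x ▷ y" (at level 40, left associativity).

HB.mixin Record isQuandle (Q : Type) := {
  qop : Q -> Q -> Q;
  qopxx : forall x, qop x x = x;
  qop_bij : forall y, bijective (qop^~ y);
  qopDl : forall w x y, qop (qop w x) y = qop (qop w y) (qop x y)
}.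

#[short(type="quandleType")]
HB.structure Definition Quandle := {Q of isQuandle Q}.

Notation "x ▷ y" := (qop x y) : ring_scope.

Definition quandle_morphism (Q Q' : quandleType) (f : Q -> Q') : Prop :=
  {morph f : x y / x ▷ y >-> x ▷ y}.

Definition quandle_isomorphic (Q Q' : quandleType) : Prop :=
  exists2 f : Q -> Q', quandle_morphism f & bijective f.

(** * Quandles presented by generators and relations *)

(* [qt_inv t u] stands for the preimage of [t] under the translation by [u]. *)
Inductive qterm (X : Type) : Type :=
| qt_gen of X
| qt_op of qterm X & qterm X
| qt_inv of qterm X & qterm X.

Arguments qt_gen {X}.
Arguments qt_op {X}.
Arguments qt_inv {X}.

HB.instance Definition _ (X : Type) := gen_eqMixin (qterm X).
HB.instance Definition _ (X : Type) := gen_choiceMixin (qterm X).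

Inductive qcongr (X : Type) (r : qterm X -> qterm X -> Prop) :
  qterm X -> qterm X -> Prop :=
| qcongr_rel t u : r t u -> qcongr r t u
| qcongr_refl t : qcongr r t t
| qcongr_sym t u : qcongr r t u -> qcongr r u t
| qcongr_trans t u v : qcongr r t u -> qcongr r u v -> qcongr r t v
| qcongr_op t t' u u' : qcongr r t t' -> qcongr r u u' ->
    qcongr r (qt_op t u) (qt_op t' u')
| qcongr_inv t t' u u' : qcongr r t t' -> qcongr r u u' ->
    qcongr r (qt_inv t u) (qt_inv t' u')
| qcongr_idem t : qcongr r (qt_op t t) t
| qcongr_opK t u : qcongr r (qt_inv (qt_op t u) u) t
| qcongr_invK t u : qcongr r (qt_op (qt_inv t u) u) t
| qcongr_dist s t u :
    qcongr r (qt_op (qt_op s t) u) (qt_op (qt_op s u) (qt_op t u)).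

Definition qcongrb X (r : qterm X -> qterm X -> Prop) : rel (qterm X) :=
  fun t u => `[< qcongr r t u >].

Lemma qcongrb_refl X (r : qterm X -> qterm X -> Prop) :
  reflexive (qcongrb r).
Proof. by move=> t; apply/asboolP; exact: qcongr_refl. Qed.

Lemma qcongrb_sym X (r : qterm X -> qterm X -> Prop) : symmetric (qcongrb r).
Proof.
by move=> t u; apply/asboolP/asboolP; exact: qcongr_sym.
Qed.

Lemma qcongrb_trans X (r : qterm X -> qterm X -> Prop) :
  transitive (qcongrb r).
Proof.
move=> u t v /asboolP tu /asboolP uv; apply/asboolP.
exact: qcongr_trans tu uv.
Qed.

Canonical qcongr_equiv X (r : qterm X -> qterm X -> Prop) :=
  EquivRel (qcongrb r) (@qcongrb_refl X r) (@qcongrb_sym X r)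
    (@qcongrb_trans X r).

Definition presented X (r : qterm X -> qterm X -> Prop) : Type :=
  {eq_quot (qcongr_equiv r)}.

Definition pclass X (r : qterm X -> qterm X -> Prop) (t : qterm X) :
  presented r := \pi_({eq_quot (qcongr_equiv r)}) t.

Definition pgen X (r : qterm X -> qterm X -> Prop) (x : X) : presented r :=
  pclass r (qt_gen x).

Definition prepr X (r : qterm X -> qterm X -> Prop) (x : presented r) :
  qterm X := repr (x : {eq_quot (qcongr_equiv r)}).

Lemma preprK X (r : qterm X -> qterm X -> Prop) :
  cancel (@prepr X r) (pclass r).
Proof. by move=> x; exact: reprK. Qed.

Lemma pclassP X (r : qterm X -> qterm X -> Prop) t u :
  pclass r t = pclass r u <-> qcongr r t u.
Proof.
split=> [/eqmodP /asboolP // | tu].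
by apply/eqmodP; apply/asboolP.
Qed.

Lemma prepr_pclass X (r : qterm X -> qterm X -> Prop) t :
  qcongr r (prepr (pclass r t)) t.
Proof. by apply/pclassP; rewrite preprK. Qed.

Definition pop X (r : qterm X -> qterm X -> Prop) (x y : presented r) :
  presented r := pclass r (qt_op (prepr x) (prepr y)).

Lemma pop_class X (r : qterm X -> qterm X -> Prop) t u :
  pop (pclass r t) (pclass r u) = pclass r (qt_op t u).
Proof. by apply/pclassP; apply: qcongr_op; exact: prepr_pclass. Qed.

Lemma popxx X (r : qterm X -> qterm X -> Prop) (x : presented r) :
  pop x x = x.
Proof.
by rewrite -[x]preprK pop_class; apply/pclassP; exact: qcongr_idem.
Qed.

Lemma pop_bij X (r : qterm X -> qterm X -> Prop) (y : presented r) :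
  bijective ((@pop X r)^~ y).
Proof.
exists (fun x => pclass r (qt_inv (prepr x) (prepr y))) => x.
  rewrite -[in RHS](preprK x); apply/pclassP.
  apply: (qcongr_trans _ (qcongr_opK r _ (prepr y))).
  by apply: qcongr_inv; [exact: prepr_pclass | exact: qcongr_refl].
rewrite -{2}(preprK y) pop_class -[RHS](preprK x); apply/pclassP.
exact: qcongr_invK.
Qed.

Lemma popDl X (r : qterm X -> qterm X -> Prop) (w x y : presented r) :
  pop (pop w x) y = pop (pop w y) (pop x y).
Proof.
rewrite -[w]preprK -[x]preprK -[y]preprK !pop_class; apply/pclassP.
exact: qcongr_dist.
Qed.

HB.instance Definition _ X (r : qterm X -> qterm X -> Prop) :=
  isQuandle.Build (presented r) (@popxx X r) (@pop_bij X r) (@popDl X r).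

(** * The translation-commutative quotient *)

Inductive tc_rel (Q : quandleType) : qterm Q -> qterm Q -> Prop :=
| tc_rel_op (p q : Q) :
    tc_rel (qt_gen (p ▷ q)) (qt_op (qt_gen p) (qt_gen q))
| tc_rel_comm (p q r : Q) :
    tc_rel (qt_op (qt_op (qt_gen p) (qt_gen q)) (qt_gen r))
           (qt_op (qt_op (qt_gen p) (qt_gen r)) (qt_gen q)).

Definition tc_quotient (Q : quandleType) : quandleType :=
  presented (@tc_rel Q).

(** * Piecewise smooth closed curves in the plane *)

Definition smooth (R : realType) (g : R -> R * R) : Prop :=
  forall (n : nat) (t : R), derivable (derive1n n g) t 1.

(* Smoothness on a compact interval is expressed by a smooth extension to the
   line, hence includes one-sided derivatives of all orders at the ends. *)
Definition smooth_on (R : realType) (a b : R) (f : R -> R * R) : Prop :=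
  exists2 g : R -> R * R, smooth g & forall t, a <= t <= b -> f t = g t.

(* [s] lists the points after 0 of a subdivision of the unit interval. *)
Definition piecewise_smooth (R : realType) (f : R -> R * R) : Prop :=
  exists s : seq R,
    [/\ path <%R 0 s, last 0 s = 1 &
        forall k, (k < size s)%N -> smooth_on (nth 0 (0 :: s) k) (nth 0 s k) f].

(* A point on a family of closed curves of period 1 is a pair of the index of
   a curve and a parameter, which is normalized to lie in [0, 1[. *)
Definition double_points (R : realType) (mu : nat)
    (gamma : 'I_mu -> R -> R * R) : set (('I_mu * R) * ('I_mu * R)) :=
  [set pq | [/\ 0 <= pq.1.2 < 1, 0 <= pq.2.2 < 1, pq.1 <> pq.2 &
                gamma pq.1.1 pq.1.2 = gamma pq.2.1 pq.2.2]].

Definition velocity (R : realType) (mu : nat) (gamma : 'I_mu -> R -> R * R)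
  (p : 'I_mu * R) : R * R := derive1 (gamma p.1) p.2.

Definition det2 (R : realType) (u v : R * R) : R := u.1 * v.2 - u.2 * v.1.

Definition transverse_at (R : realType) (mu : nat)
    (gamma : 'I_mu -> R -> R * R) (p q : 'I_mu * R) : Prop :=
  [/\ derivable (gamma p.1) p.2 1, derivable (gamma q.1) q.2 1 &
      det2 (velocity gamma p) (velocity gamma q) != 0].

(** * Oriented virtual link diagrams *)

(* [classical_crossings D] contains [(p, q)] when [p] and [q] are the over- and
   underpassing points at a classical crossing.  A crossing [{p, q}] for which
   neither [(p, q)] nor [(q, p)] belongs to it is virtual.
   The curves are oriented by increasing parameter. *)
Record diagram (R : realType) := Diagram {
  ncomp : nat;
  curve : 'I_ncomp -> R -> R * R;
  classical_crossings : set (('I_ncomp * R) * ('I_ncomp * R));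
  curve_periodic : forall i t, curve i (t + 1) = curve i t;
  curve_piecewise_smooth : forall i, piecewise_smooth (curve i);
  finite_double_points : finite_set (double_points curve);
  no_triple_points : forall p q q', double_points curve (p, q) ->
    double_points curve (p, q') -> q = q';
  double_points_transverse : forall p q, double_points curve (p, q) ->
    transverse_at curve p q;
  classical_crossings_sub : classical_crossings `<=` double_points curve;
  classical_crossings_asym : forall p q,
    classical_crossings (p, q) -> ~ classical_crossings (q, p)
}.

Arguments curve {R} d i t.
Arguments classical_crossings {R} d.

Definition point (R : realType) (D : diagram R) : Type :=
  ('I_(ncomp D) * R)%type.

(* The determinant is positive exactly when the underpassing direction points
   to the left of the overpassing one, that is, when the underpassing segment
   crosses from right to left. *)
Definition writhe (R : realType) (D : diagram R) (c : point D * point D) :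
    int :=
  if 0 < det2 (velocity (@curve R D) c.1) (velocity (@curve R D) c.2)
  then 1 else -1.

Definition over_crossings (R : realType) (D : diagram R)
    (j i : 'I_(ncomp D)) : set (point D * point D) :=
  [set c | [/\ classical_crossings D c, c.1.1 = j & c.2.1 = i]].

(* The linking number of the [j]-th component over the [i]-th one. *)
Definition linking_number (R : realType) (D : diagram R)
    (j i : 'I_(ncomp D)) : int :=
  \sum_(c \in over_crossings j i) writhe c.

(** * Arcs and the link quandle *)

Definition under_params (R : realType) (D : diagram R) (i : 'I_(ncomp D)) :
    set R :=
  [set t | exists c : point D * point D, exists n : int,
    [/\ classical_crossings D c, c.2.1 = i & t = c.2.2 + n%:~R]].

(* The component of [t] in the closed curve [i] cut at its underpassing points,
   as a set of parameters of period 1. *)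
Definition arc_params (R : realType) (D : diagram R) (i : 'I_(ncomp D))
    (t : R) : set R :=
  [set s | exists n : int,
    connected_component (~` under_params i) t (s + n%:~R)].

(* Arcs are sets of parameters and not sets of points in the plane: an arc is
   not cut, and two arcs are not merged, where they meet at a crossing. *)
Record arc (R : realType) (D : diagram R) := Arc {
  arc_comp : 'I_(ncomp D);
  arc_set : set R;
  arcP : exists2 t, ~ under_params arc_comp t & arc_set = arc_params arc_comp t
}.

Definition passes (R : realType) (D : diagram R) (a : arc D) (p : point D) :
  Prop := arc_comp a = p.1 /\ arc_set a p.2.

Definition arc_before (R : realType) (D : diagram R) (p : point D)
    (a : arc D) : Prop :=
  arc_comp a = p.1 /\ \forall t \near p.2^'-, arc_set a t.

Definition arc_after (R : realType) (D : diagram R) (p : point D)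
    (a : arc D) : Prop :=
  arc_comp a = p.1 /\ \forall t \near p.2^'+, arc_set a t.

(* The underpassing arcs on the right and on the left of the overpassing one. *)
Definition right_arc (R : realType) (D : diagram R) (c : point D * point D) :
    arc D -> Prop :=
  if writhe c == 1 then arc_before c.2 else arc_after c.2.

Definition left_arc (R : realType) (D : diagram R) (c : point D * point D) :
    arc D -> Prop :=
  if writhe c == 1 then arc_after c.2 else arc_before c.2.

Inductive link_rel (R : realType) (D : diagram R) :
    qterm (arc D) -> qterm (arc D) -> Prop :=
| link_rel_crossing (c : point D * point D) (a1 a2 a3 : arc D) :
    classical_crossings D c ->
    passes a1 c.1 -> right_arc c a2 -> left_arc c a3 ->
    link_rel (qt_gen a3) (qt_op (qt_gen a2) (qt_gen a1)).

Definition link_quandle (R : realType) (D : diagram R) : quandleType :=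
  presented (@link_rel R D).

(* Main.v *)
From HB Require Import structures.
From mathcomp Require Import all_boot all_order all_algebra.
From mathcomp Require Import all_classical all_reals all_analysis.
From mathcomp Require Import lra.
Require Import Defs.
Import Order.TTheory GRing.Theory Num.Theory.
Import numFieldNormedType.Exports.

(** In a translation-commutative quandle [x ▷ (y ▷ z) = x ▷ y], so the
    translation by an element depends only on its orbit.  In [Q_tc(L)] the arcs
    of one component lie in one orbit, because consecutive arcs differ by the
    translation by the overpassing arc.  Hence [n] commuting translations, one
    for each component, generate everything: [Z^n] acts on the quandle, and
    there is one orbit for each component.  Walking once around the [i]-th
    component applies [l_{j/i}] times the [j]-th translation for each [j], so
    the vector [l_i = (l_{j/i})_j] fixes the [i]-th orbit; so does the [i]-th
    basis vector, by idempotence.  There are no other stabilizers: the quandle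
    is the disjoint union over [i] of the groups [Z^n / <e_i, l_i>], on which
    elements of the [j]-th orbit translate by [e_j].

    This description is the record [coordinates], and [tc_link_coordinates]
    establishes it for a diagram.  An isomorphism permutes the orbits and the
    basis vectors in the same way, and so matches the subgroups
    [<e_i, l_i>].  Off the [i]-th coordinate, [l_i] and the corresponding
    vector of the other link are thus integer multiples of each other, that
    is, equal up to a sign [eps_i]; conversely, such signs give an isomorphism
    ([isomorphic_coordinates]).

    To follow a component, its curve is unrolled to the real line.  The
    function [undercount] records the signed number of underpasses up to a
    parameter; it is constant between underpasses and jumps at them exactly
    as the arcs do in the quandle.  So the element of an arc, moved back by
    the undercount, is locally constant along the line, hence constant
    ([arc_transport]).  That the stabilizers are not larger is seen by a
    morphism to a quandle of subsets of [Z^n] ([link_quandle_hom]). *)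

Set Implicit Arguments.
Unset Strict Implicit.
Unset Printing Implicit Defensive.
Local Open Scope classical_set_scope.
Local Open Scope ring_scope.

(** * Quandles and presentations *)

Section Translations.
Variable Q : quandleType.
Implicit Types x y z : Q.

Lemma qop_inj y : injective (fun x => x ▷ y).
Proof. exact: bij_inj (qop_bij y). Qed.

Lemma qop_surj x y : exists z, z ▷ y = x.
Proof. by have [g _ gK] := qop_bij y; exists (g x); exact: gK. Qed.

Definition qdiv x y : Q := sval (cid (qop_surj x y)).

Lemma qdivK x y : qdiv x y ▷ y = x.
Proof. by rewrite /qdiv; case: cid. Qed.

Lemma qopK x y : qdiv (x ▷ y) y = x.
Proof. by apply: (@qop_inj y); rewrite qdivK. Qed.

Definition translation_commutative := forall x y z, x ▷ y ▷ z = x ▷ z ▷ y.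

(** Writing [x] as [w ▷ z], distributivity gives
    [x ▷ (y ▷ z) = w ▷ y ▷ z], and commutativity turns this into [x ▷ y]. *)
Lemma tc_qop_qop : translation_commutative ->
  forall x y z, x ▷ (y ▷ z) = x ▷ y.
Proof.
by move=> tcQ x y z; have [w <-] := qop_surj x z; rewrite -qopDl tcQ.
Qed.

End Translations.

Section Presented.
Variables (X : Type) (r : qterm X -> qterm X -> Prop).

Lemma pclassM t u : pclass r t ▷ pclass r u = pclass r (qt_op t u).
Proof. exact: pop_class. Qed.

Lemma presented_ind (P : presented r -> Prop) :
  (forall x, P (pgen r x)) ->
  (forall x y, P x -> P y -> P (x ▷ y)) ->
  (forall x y, P (x ▷ y) -> P y -> P x) ->
  forall x, P x.
Proof.
move=> Pgen Pop Pdiv x; rewrite -(preprK x); elim: (prepr x) => //.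
  by move=> t Pt u Pu; rewrite -pclassM; exact: Pop.
move=> t Pt u Pu; apply: (Pdiv _ (pclass r u)) => //.
rewrite pclassM; suff -> : pclass r (qt_op (qt_inv t u) u) = pclass r t by [].
by apply/pclassP; exact: qcongr_invK.
Qed.

Variable M : quandleType.

Fixpoint qeval (h : X -> M) (t : qterm X) : M :=
  match t with
  | qt_gen x => h x
  | qt_op t u => qeval h t ▷ qeval h u
  | qt_inv t u => qdiv (qeval h t) (qeval h u)
  end.

(** The universal property of a presentation. *)
Lemma presented_lift (h : X -> M) :
  (forall t u, r t u -> qeval h t = qeval h u) ->
  exists2 F : presented r -> M,
    quandle_morphism F & forall x, F (pgen r x) = h x.
Proof.
move=> hr; have hcongr t u : qcongr r t u -> qeval h t = qeval h u.
  elim=> //= {t u}; first by move=> t u v _ -> _ ->.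
  - by move=> t t' u u' _ -> _ ->.
  - by move=> t t' u u' _ -> _ ->.
  - by move=> t; rewrite qopxx.
  - by move=> t u; rewrite qopK.
  - by move=> t u; rewrite qdivK.
  - by move=> s t u; rewrite qopDl.
have hE t : qeval h (prepr (pclass r t)) = qeval h t.
  by apply: hcongr; exact: prepr_pclass.
exists (fun x => qeval h (prepr x)) => [x y|x]; first by rewrite hE.
by rewrite hE.
Qed.

End Presented.

(** * The translation-commutative quotient *)

Section TcQuotient.
Variable Q : quandleType.

Definition tc_proj (x : Q) : tc_quotient Q := pgen (@tc_rel Q) x.

Lemma tc_projM : quandle_morphism tc_proj.
Proof.
move=> x y; rewrite /tc_proj /pgen pclassM.
by apply/pclassP/qcongr_rel; exact: tc_rel_op.
Qed.

(** The generators [x_q] are closed under the operation by the first family of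
    relations, and under its inverse because [Q] itself is a quandle. *)
Lemma tc_proj_surj (y : tc_quotient Q) : exists x, y = tc_proj x.
Proof.
elim/presented_ind: y => [x||]; first by exists x.
  by move=> _ _ [x ->] [y ->]; exists (x ▷ y); rewrite tc_projM.
move=> z w [x zw] [y wE]; exists (qdiv x y).
by apply: (@qop_inj _ (tc_proj y)); rewrite -tc_projM qdivK -zw wE.
Qed.

Lemma tc_quotient_tc : translation_commutative (tc_quotient Q).
Proof.
move=> x y z; have [p ->] := tc_proj_surj x; have [q ->] := tc_proj_surj y.
have [s ->] := tc_proj_surj z; rewrite /tc_proj /pgen.
rewrite !(pclassM _ (qt_gen p)) !(pclassM _ (qt_op (qt_gen p) _) (qt_gen _)).
by apply/pclassP/qcongr_rel; exact: tc_rel_comm.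
Qed.

Lemma tc_quotient_lift (M : quandleType) (h : Q -> M) :
  translation_commutative M -> quandle_morphism h ->
  exists2 F : tc_quotient Q -> M,
    quandle_morphism F & forall x, F (tc_proj x) = h x.
Proof.
move=> tcM hM; apply: presented_lift => t u.
by case=> /= [p q|p q s]; [exact: hM | exact: tcM].
Qed.

End TcQuotient.

(** * Coordinates on translation-commutative quandles *)

(** The class of [v] modulo [e_i] and the vector [l_i] with entries [l j i].
    Idempotence makes [e_i] act trivially on the [i]-th orbit, which is why the
    [i]-th entry is ignored. *)
Definition coset n (l : 'I_n -> 'I_n -> int) (i : 'I_n) (v : 'rV[int]_n) :
    set 'rV[int]_n :=
  [set w | exists k : int, forall j, j <> i -> w 0 j - v 0 j = k * l j i].

(** [pt i v] is the translate by [v] of a base point of the [i]-th orbit. *)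
Record coordinates (Q : quandleType) n (l : 'I_n -> 'I_n -> int)
    (pt : 'I_n -> 'rV[int]_n -> Q) : Prop := Coordinates {
  pt_surj : forall x, exists i v, x = pt i v;
  pt_op : forall i j v w, pt i v ▷ pt j w = pt i (v + delta_mx 0 j);
  pt_eq : forall i j v w, pt i v = pt j w <-> i = j /\ coset l i w v
}.

(** The lattice is generated by the basis vectors; the equivalence in the
    step allows walking in both directions from an arbitrary start. *)
Lemma rV_int_ind n (P : 'rV[int]_n -> Prop) v0 :
  P v0 -> (forall v j, P v <-> P (v + delta_mx 0 j)) -> forall v, P v.
Proof.
move=> P0 PD.
have PZ j (z : int) v : P v <-> P (v + z *: delta_mx 0 j).
  elim/int_ind: z v => [|m IH|m IH] v; first by rewrite scale0r addr0.
    by rewrite intS scalerDl scale1r addrA -IH.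
  by rewrite intS opprD scalerDl scaleN1r addrA -IH (PD (v - _) j) subrK.
have PS (s : seq 'I_n) (u : 'I_n -> int) :
    P (v0 + \sum_(j <- s) u j *: delta_mx 0 j).
  elim: s => [|j s IH]; first by rewrite big_nil addr0.
  by rewrite big_cons addrCA addrC -PZ.
by move=> v; rewrite -[v](subrK v0) addrC [v - v0]row_sum_delta.
Qed.

Section CoordinatesMorphism.
Variables (Q Q' : quandleType) (n n' : nat).
Variables (l : 'I_n -> 'I_n -> int) (l' : 'I_n' -> 'I_n' -> int).
Variables (pt : 'I_n -> 'rV[int]_n -> Q) (pt' : 'I_n' -> 'rV[int]_n' -> Q').
Hypotheses (ptP : coordinates l pt) (ptP' : coordinates l' pt').

Definition reindex (s : 'I_n -> 'I_n') (v : 'rV[int]_n) : 'rV[int]_n' :=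
  \sum_j v 0 j *: delta_mx 0 (s j).

Lemma reindexD s v j :
  reindex s (v + delta_mx 0 j) = reindex s v + delta_mx 0 (s j).
Proof.
rewrite /reindex (bigD1 j) //= [X in _ = X + _](bigD1 j) //= !mxE !eqxx.
rewrite scalerDl scale1r addrAC; congr (_ + _ + _).
by apply: eq_bigr => k /negPf kj; rewrite !mxE kj addr0.
Qed.

Lemma reindexE s v j : injective s -> reindex s v 0 (s j) = v 0 j.
Proof.
move=> sI; rewrite summxE (bigD1 j) //= !mxE !eqxx mulr1 big1 ?addr0 // => k kj.
by rewrite !mxE (inj_eq sI) eq_sym (negPf kj) mulr0.
Qed.

(** The loop around the [i]-th component. *)
Lemma coordinates_linking i : pt i (\row_j l j i) = pt i 0.
Proof.
by apply/(pt_eq ptP); split=> //; exists 1 => j _; rewrite !mxE subr0 mul1r.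
Qed.

(** A morphism carries the translation by an orbit to the translation by the
    image orbit, so it is affine in the coordinates.  The loop
    [pt i (l_i) = pt i 0] then shows that [l_i] is a multiple of
    [l'_(s i)]. *)
Lemma morphism_coordinates (f : Q -> Q') : quandle_morphism f ->
  exists s : 'I_n -> 'I_n',
    (forall i v, exists w, f (pt i v) = pt' (s i) w) /\
    (injective s -> forall i, exists k : int,
      forall j, j <> i -> l j i = k * l' (s j) (s i)).
Proof.
move=> fM.
have /choice[s /choice[u fu]] : forall i, exists k w, f (pt i 0) = pt' k w.
  by move=> i; exact: (pt_surj ptP').
have fpt i v : f (pt i v) = pt' (s i) (u i + reindex s v).
  move: v; apply: (@rV_int_ind _ _ 0) => [|v j].
    rewrite fu /reindex big1 ?addr0 // => j _.
    by rewrite mxE scale0r.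
  rewrite reindexD addrA -(pt_op ptP _ j _ 0) -(pt_op ptP' _ _ _ (u j)) fM fu.
  by split=> [->//|]; exact: qop_inj.
exists s; split=> [i v|sI i]; first by exists (u i + reindex s v).
have /(congr1 f) := coordinates_linking i; rewrite !fpt.
move=> /(pt_eq ptP')[_ [k kE]]; exists k => j ji.
have /kE : s j <> s i by move/sI.
by rewrite mxE [X in _ - X]mxE !reindexE // !mxE addr0 addrAC subrr add0r.
Qed.

(** Elements are moved through any choice of their coordinates.  The
    hypothesis is that [reindex s] respects and reflects the classes, which
    makes the result independent of the choice and injective. *)
Lemma reindex_isomorphism (s : 'I_n -> 'I_n') : bijective s ->
  (forall i v w,
     coset l i v w <-> coset l' (s i) (reindex s v) (reindex s w)) ->
  quandle_isomorphic Q Q'.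
Proof.
move=> s_bij sE.
have /choice[c /choice[v cv]] := pt_surj ptP.
pose f x := pt' (s (c x)) (reindex s (v x)).
have fpt i w : f (pt i w) = pt' (s i) (reindex s w).
  have /(pt_eq ptP)[ci /sE] := cv (pt i w); rewrite /f -ci => siw.
  by apply/esym/(pt_eq ptP'); split.
have fM : quandle_morphism f.
  move=> x y; rewrite [x]cv [y]cv (pt_op ptP) !fpt reindexD.
  by rewrite (pt_op ptP').
have f_inj : injective f.
  move=> x y; rewrite [in X in X -> _](cv x) [in X in X -> _](cv y) !fpt.
  move=> /(pt_eq ptP')[/(bij_inj s_bij) xy xyE]; rewrite [x]cv [y]cv.
  by apply/(pt_eq ptP); split=> //; apply/sE.
have /choice[g gK] : forall y, exists x, f x = y.
  move=> y; have [k [w ->]] := pt_surj ptP' y; have [t _ tK] := s_bij.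
  exists (pt (t k) (\row_j w 0 (s j))); rewrite fpt tK; congr (pt' _ _).
  apply/rowP => j; rewrite -[j]tK reindexE; last exact: bij_inj.
  by rewrite mxE.
by exists f => //; exists g => // x; apply: f_inj; rewrite gK.
Qed.

End CoordinatesMorphism.

(** If some entry of [a] on [P] is nonzero, then [k * m = 1] and [k] is a unit
    of the integers; otherwise both families vanish and any sign will do. *)
Lemma int_mutual_multiples n (P : pred 'I_n) (a b : 'I_n -> int) (k m : int) :
  (forall j, P j -> a j = k * b j) -> (forall j, P j -> b j = m * a j) ->
  exists2 e : int, e \in [:: -1; 1] & forall j, P j -> a j = e * b j.
Proof.
move=> ak bm.
have [/existsP[j /andP[Pj aj0]]|] := boolP [exists j, P j && (a j != 0)].
  exists k => //; have := ak j Pj; rewrite (bm j Pj) mulrA => /esym/eqP.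
  rewrite -subr_eq0 -[X in _ - X]mul1r -mulrBl mulf_eq0 (negPf aj0) orbF.
  rewrite subr_eq0.
  move=> /eqP/(congr1 absz); rewrite abszM => /eqP.
  rewrite muln_eq1 => /andP[+ _].
  by rewrite !inE; case: k {ak} => [[|[|]]|[|]].
rewrite negb_exists => /forallP a0; exists 1 => [|j Pj].
  by rewrite !inE eqxx orbT.
have aj0 : a j = 0 by have := a0 j; rewrite Pj => /negbNE/eqP.
by rewrite bm // aj0 !mulr0.
Qed.

Section Classification.
Variables (Q Q' : quandleType) (n n' : nat).
Variables (l : 'I_n -> 'I_n -> int) (l' : 'I_n' -> 'I_n' -> int).
Variables (pt : 'I_n -> 'rV[int]_n -> Q) (pt' : 'I_n' -> 'rV[int]_n' -> Q').
Hypotheses (ptP : coordinates l pt) (ptP' : coordinates l' pt').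

(** An isomorphism and its inverse express each of [l_i] and [l'_(s i)] as a
    multiple of the other. *)
Lemma isomorphic_coordinates : quandle_isomorphic Q Q' <->
  exists s : 'I_n -> 'I_n', exists2 eps : 'I_n -> int,
    bijective s /\ (forall i, eps i \in [:: -1; 1]) &
    forall i j, i <> j -> l j i = eps i * l' (s j) (s i).
Proof.
split=> [[f fM [g fK gK]]|[s [eps [s_bij epsE] lE]]].
  have gM : quandle_morphism g by move=> x y; rewrite -[x]gK -[y]gK -fM !fK.
  have [s [fs sE]] := morphism_coordinates ptP ptP' fM.
  have [t [gt tE]] := morphism_coordinates ptP' ptP gM.
  have sK : cancel s t.
    move=> i; have [w /(congr1 g)] := fs i 0; have [w' ->] := gt (s i) w.
    by rewrite fK => /(pt_eq ptP)[].
  have tK : cancel t s.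
    move=> i; have [w /(congr1 f)] := gt i 0; have [w' ->] := fs (t i) w.
    by rewrite gK => /(pt_eq ptP')[].
  have /choice[eps epsE] : forall i, exists e : int,
      e \in [:: -1; 1] /\ forall j, j != i -> l j i = e * l' (s j) (s i).
    move=> i; have [k kE] := sE (can_inj sK) i.
    have [m mE] := tE (can_inj tK) (s i).
    have l'E j : j != i -> l' (s j) (s i) = m * l j i.
      by move=> /eqP ji; rewrite mE ?sK // => /(can_inj sK).
    have [|e eE leE] := @int_mutual_multiples _ [pred j | j != i] (l^~ i)
      (fun j => l' (s j) (s i)) k m _ l'E; last by exists e.
    by move=> j /eqP; exact: kE.
  exists s, eps; first by split=> [|i]; [exists t | have [] := epsE i].
  by move=> i j ij; have [_] := epsE i; apply; apply/eqP => ji; exact: ij.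
apply: (reindex_isomorphism ptP ptP' s_bij) => i v w.
have eps1 : eps i * eps i = 1.
  by have := epsE i; rewrite !inE => /orP[]/eqP->.
have sI := bij_inj s_bij; have [t sK tK] := s_bij.
split=> [[k kE]|[k kE]].
  exists (k * eps i) => j ji.
  have jt : t j <> i by move=> ij; apply: ji; rewrite -ij tK.
  by rewrite -[j]tK !reindexE // kE // lE ?mulrA //; exact/nesym.
exists (k * eps i) => j ji; rewrite lE; last exact/nesym.
rewrite mulrA -[k * _ * _]mulrA eps1 mulr1 -kE ?reindexE //.
by move/sI.
Qed.

End Classification.

(** * The action of integer vectors on a translation-commutative quandle *)

Section Action.
Variable Q : quandleType.
Hypothesis tcQ : translation_commutative Q.

Definition qpow (y : Q) (k : int) (x : Q) : Q :=
  match k with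
  | Posz m => iter m (fun x => x ▷ y) x
  | Negz m => iter m.+1 (fun x => qdiv x y) x
  end.

Lemma qpow_succ y k x : qpow y (k + 1) x = qpow y k x ▷ y.
Proof.
case: k => [m|[|m]]; first by rewrite addrC -intS.
  by rewrite /= qdivK.
rewrite (_ : Negz m.+1 + 1 = Negz m) /= ?qdivK //.
by rewrite !NegzE intS opprD addrAC addNr add0r.
Qed.

Lemma qpow_pred y k x : qpow y (k - 1) x ▷ y = qpow y k x.
Proof. by rewrite -qpow_succ subrK. Qed.

Lemma qpowD y k m x : qpow y (k + m) x = qpow y k (qpow y m x).
Proof.
elim/int_ind: k => [|k IH|k IH]; first by rewrite add0r.
  by rewrite intS [1 + _]addrC addrAC !qpow_succ IH.
apply: (@qop_inj _ y); rewrite intS opprD [-1 + _]addrC qpow_pred -IH.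
by rewrite addrAC qpow_pred.
Qed.

Lemma qpow_qop y k x z : qpow y k x ▷ z = qpow y k (x ▷ z).
Proof.
elim/int_ind: k => [//|k IH|k IH].
  by rewrite intS addrC !qpow_succ tcQ IH.
apply: (@qop_inj _ y); rewrite intS opprD [-1 + _]addrC qpow_pred -IH.
by rewrite tcQ qpow_pred.
Qed.

Lemma qpowC y k z m x : qpow y k (qpow z m x) = qpow z m (qpow y k x).
Proof.
elim/int_ind: k => [//|k IH|k IH].
  by rewrite intS addrC !qpow_succ IH qpow_qop.
apply: (@qop_inj _ y); rewrite intS opprD [-1 + _]addrC qpow_pred.
rewrite [RHS]qpow_qop qpow_pred.
exact: IH.
Qed.

Variables (n : nat) (g : 'I_n -> Q).

Definition qact_seq (s : seq 'I_n) (v : 'rV[int]_n) (x : Q) : Q :=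
  foldr (fun j => qpow (g j) (v 0 j)) x s.

Lemma qpow_qact y k s v x :
  qpow y k (qact_seq s v x) = qact_seq s v (qpow y k x).
Proof. by elim: s => //= j s IH; rewrite qpowC IH. Qed.

(** Additivity needs the powers of the various translations to commute. *)
Lemma qact_seqD s v w x : qact_seq s (v + w) x = qact_seq s v (qact_seq s w x).
Proof. by elim: s => //= j s IH; rewrite mxE qpowD IH qpow_qact. Qed.

Lemma qact_seq_delta s j x : uniq s ->
  qact_seq s (delta_mx 0 j) x = if j \in s then x ▷ g j else x.
Proof.
elim: s => //= k s IH /andP[ks us]; rewrite IH // mxE eqxx inE eq_sym.
by have [<-|//] := eqVneq k j; rewrite (negPf ks).
Qed.

Definition qact := qact_seq (enum 'I_n).

Lemma qactD v w x : qact (v + w) x = qact v (qact w x).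
Proof. exact: qact_seqD. Qed.

Lemma qact_delta j x : qact (delta_mx 0 j) x = x ▷ g j.
Proof. by rewrite /qact qact_seq_delta ?enum_uniq // mem_enum. Qed.

Lemma qact0 x : qact 0 x = x.
Proof. by rewrite /qact; elim: (enum _) => //= j s ->; rewrite mxE. Qed.

Lemma qactK v : cancel (qact v) (qact (- v)).
Proof. by move=> x; rewrite -qactD addNr qact0. Qed.

Lemma qactVK v : cancel (qact (- v)) (qact v).
Proof. by move=> x; rewrite -qactD subrr qact0. Qed.

Lemma qact_fixZ v k x : qact v x = x -> qact (k *: v) x = x.
Proof.
move=> vx; elim/int_ind: k => [|k IH|k IH]; first by rewrite scale0r qact0.
  by rewrite intS scalerDl scale1r qactD IH.
by rewrite intS opprD scalerDl scaleN1r qactD IH -[in LHS]vx qactK.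
Qed.

(** The image of a translate by the action lies in the same orbit, so it
    translates in the same way. *)
Lemma qop_qact v x z : x ▷ qact v z = x ▷ z.
Proof.
have tcop := tc_qop_qop tcQ.
apply: (@rV_int_ind _ (fun v => x ▷ qact v z = x ▷ z) 0) => [|w j].
  by rewrite qact0.
by rewrite addrC qactD qact_delta tcop.
Qed.

End Action.

(** * Underpassing points and arcs *)

Lemma floor_const (R : realType) (s t : R) : s <= t ->
  (forall k : int, s <= k%:~R <= t -> False) -> Num.floor s = Num.floor t.
Proof.
move=> st noint; apply/eqP; rewrite eq_le le_floor //= leNgt; apply/negP => lt.
apply: (noint (Num.floor t)); rewrite floor_le andbT ltW //.
by rewrite -floor_lt_int.
Qed.

Lemma floor_jump (R : realType) (s t : R) (k : int) : s < k%:~R < t ->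
  (forall m : int, s <= m%:~R <= t -> m = k) -> Num.floor t = Num.floor s + 1.
Proof.
move=> /andP[sk kt] onek; have k_eq m : s <= m%:~R <= t -> m%:~R = k%:~R :> R.
  by move/onek->.
have -> : Num.floor t = k.
  apply: floor_def; rewrite (ltW kt) ltNge; apply/negP => k1t.
  by have := k_eq (k + 1); rewrite intrD; lra.
rewrite (@floor_def _ s (k - 1)) ?subrK // sk andbT intrB leNgt.
apply/negP => sk1.
by have := k_eq (k - 1); rewrite intrB; lra.
Qed.

Section Diagram.
Variables (R : realType) (D : diagram R).
Local Notation n := (ncomp D).
Local Notation U := (@under_params R D).
Implicit Types (i j : 'I_n) (a b : arc D) (s t x y : R).
Implicit Types (c : point D * point D) (k : int).

Lemma finite_classical_crossings : finite_set (classical_crossings D).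
Proof.
apply: sub_finite_set (@classical_crossings_sub R D) _.
exact: finite_double_points.
Qed.

Lemma finite_over_crossings j i : finite_set (over_crossings j i).
Proof. by apply: sub_finite_set finite_classical_crossings => c []. Qed.

Lemma double_points_sym (p q : point D) :
  double_points (@curve R D) (p, q) -> double_points (@curve R D) (q, p).
Proof. by case=> /= p1 q1 pq e; split=> //= /esym. Qed.

Lemma under_point_inj c c' : classical_crossings D c ->
  classical_crossings D c' -> c.2 = c'.2 -> c = c'.
Proof.
case: c c' => [p q] [p' q'] /= cc cc' qq; rewrite -qq in cc' *.
congr pair; apply: (@no_triple_points _ D q).
  exact/double_points_sym/classical_crossings_sub.
exact/double_points_sym/classical_crossings_sub.
Qed.

Lemma crossing_params c : classical_crossings D c ->
  (0 <= c.1.2 < 1) /\ (0 <= c.2.2 < 1).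
Proof. by move/classical_crossings_sub => []. Qed.

Lemma eq_mod1 (s t : R) k : 0 <= s < 1 -> 0 <= t < 1 -> s = t + k%:~R -> s = t.
Proof.
move=> /andP[s0 s1] /andP[t0 t1] st; suff k0 : k = 0 by rewrite st k0 addr0.
have kE : k%:~R = s - t by rewrite st addrAC subrr add0r.
have : (-1)%:~R < (k%:~R : R) by rewrite mulrN1z kE; lra.
have : k%:~R < (1%:~R : R) by rewrite mulr1z kE; lra.
by rewrite !ltr_int; case: k {st kE} => [[|m]|[|m]].
Qed.

(** If the overpassing point [p] of a crossing [(p, q)] also passed under some
    [r], then [r = q] as there are no triple points, and both [(p, q)] and
    [(q, p)] would be classical.  So every crossing has an overpassing arc. *)
Lemma over_point_not_under c : classical_crossings D c -> ~ U c.1.1 c.1.2.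
Proof.
move=> cc [c' [k [cc' ic kE]]].
have pq : c'.2 = c.1.
  move: (crossing_params cc) (crossing_params cc') => [c1 _] [_ c2].
  by rewrite [LHS]surjective_pairing ic -(eq_mod1 c1 c2 kE) -surjective_pairing.
have : c'.1 = c.2.
  apply: (@no_triple_points _ D c.1); last first.
    by apply: classical_crossings_sub; rewrite -surjective_pairing.
  rewrite -pq; apply/double_points_sym/classical_crossings_sub.
  by rewrite -surjective_pairing.
move=> qp; apply: (@classical_crossings_asym _ D c.1 c.2).
  by rewrite -surjective_pairing.
by rewrite -pq -qp -surjective_pairing.
Qed.

Lemma under_paramsD i s k : U i s -> U i (s + k%:~R).
Proof.
move=> [c [m [cc ci ->]]]; exists c, (m + k); split=> //.
by rewrite intrD addrA.
Qed.

Lemma translates_discrete (p x : R) : exists2 e, 0 < e &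
  forall k, x - e <= p + k%:~R <= x + e -> p + k%:~R = x.
Proof.
pose z := x - p; pose d1 := (Num.floor z + 1)%:~R - z.
pose d2 := z - (Num.ceil z - 1)%:~R.
have d1_gt0 : 0 < d1 by rewrite subr_gt0 floorD1_gt.
have d2_gt0 : 0 < d2 by rewrite subr_gt0 ceilB1_lt.
(* The integers strictly between [z - d2] and [z + d1] lie between the ceiling
   and the floor of [z], hence equal [z]. *)
have [e e0 [e1 e2]] : exists2 e, 0 < e & e < d1 /\ e < d2.
  have m0 : 0 < Num.min d1 d2 by rewrite lt_min d1_gt0.
  exists (Num.min d1 d2 / 2); first by rewrite divr_gt0.
  have : Num.min d1 d2 / 2 < Num.min d1 d2 by lra.
  by rewrite lt_min => /andP[].
exists e => // k /andP[kl kr].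
have : (Num.ceil z - 1)%:~R < (k%:~R : R) by rewrite /d2 /z in e2 *; lra.
rewrite ltr_int -lezD1 subrK -(ler_int R) => kge.
have : (k%:~R : R) < (Num.floor z + 1)%:~R by rewrite /d1 /z in e1 *; lra.
rewrite ltr_int ltzD1 -(ler_int R) => kle.
have := floor_le z; have := ceil_ge z; rewrite /z in kge kle *; lra.
Qed.

(** The underpassing parameters are finitely many translates of the integers,
    so each point has a neighborhood containing no other one. *)
Lemma under_params_discrete i x :
  exists2 e, 0 < e & forall y, x - e <= y <= x + e -> U i y -> y = x.
Proof.
have /finite_seqP[r rE] := finite_classical_crossings.
have [e e0 eE] : exists2 e, 0 < e & forall c, c \in r -> forall k,
    x - e <= c.2.2 + k%:~R <= x + e -> c.2.2 + k%:~R = x.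
  elim: r {rE} => [|c r [e e0 eE]]; first by exists 1.
  have [d d0 dE] := translates_discrete c.2.2 x.
  exists (Num.min d e) => [|c' c'r k]; first by rewrite lt_min d0.
  have m1 : Num.min d e <= d by rewrite ge_min lexx.
  have m2 : Num.min d e <= e by rewrite ge_min lexx orbT.
  move: c'r; rewrite inE => /orP[/eqP->|c'r] kE; first by apply: dE; lra.
  by apply: eE => //; lra.
exists e => // y yE [c [k [cc ci yk]]]; rewrite yk.
apply: eE; last by rewrite -yk.
by move: cc; rewrite rE.
Qed.

Lemma arc_not_under a s : arc_set a s -> ~ U (arc_comp a) s.
Proof.
have [t tU ->] := arcP a.
case=> [k /connected_component_sub sU] /(under_paramsD k).
exact: sU.
Qed.

Lemma arc_setD a s k : arc_set a s -> arc_set a (s + k%:~R).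
Proof.
have [t tU ->] := arcP a; case=> m sm; exists (m - k).
by rewrite intrB -addrA [k%:~R + _]addrC subrK.
Qed.

Lemma component_segment i s t : s <= t ->
  connected_component (~` U i) s t <-> forall y, s <= y <= t -> ~ U i y.
Proof.
move=> st; split=> [stU y sy|stU].
  suff : connected_component (~` U i) s y by move/connected_component_sub.
  have /connected_intervalP sI := @component_connected _ (~` U i) s.
  apply: (sI s t) => //; apply: connected_component_refl.
  exact: connected_component_sub (connected_component_sym stU).
exists `[s, t]%classic; last by rewrite /= in_itv /= lexx st.
split; first by rewrite /= in_itv /= lexx st.
  by move=> y /=; rewrite in_itv /=; exact: stU.
exact: segment_connected.
Qed.

Lemma component_shift i s t k : connected_component (~` U i) s t ->
  connected_component (~` U i) (s + k%:~R) (t + k%:~R).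
Proof.
wlog st : s t / s <= t => [wlog_st|/(component_segment _ st) stU].
  have [/wlog_st//|/ltW/wlog_st ts /connected_component_sym/ts] := leP s t.
  exact: connected_component_sym.
apply/component_segment => [|y /andP[sy yt] /(under_paramsD (- k))].
  by rewrite lerD2r.
by apply: stU; rewrite intrN; lra.
Qed.

Lemma arc_params_eq i s t : arc_params i s t -> arc_params i s = arc_params i t.
Proof.
move=> [k st]; apply/predeqP => y; split=> -[m ym].
  exists (m - k).
  have /(component_shift (- k)) :=
    connected_component_trans (connected_component_sym st) ym.
  by rewrite !intrD intrN addrK addrA.
exists (m + k); apply: connected_component_trans st _.
by rewrite intrD addrA; exact: component_shift.
Qed.

Lemma arc_setE a s t : arc_set a s ->
  arc_set a t <-> arc_params (arc_comp a) s t.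
Proof. by have [x xU ->] := arcP a; move/arc_params_eq->. Qed.

Lemma arc_set_segment a s t : s <= t ->
  (forall y, s <= y <= t -> ~ U (arc_comp a) y) -> arc_set a s <-> arc_set a t.
Proof.
move=> st /(component_segment _ st) stC; split=> [sA|tA].
  by apply/(arc_setE _ sA); exists 0; rewrite addr0.
apply/(arc_setE _ tA); exists 0; rewrite addr0.
exact: connected_component_sym.
Qed.

Lemma arc_exists i s : ~ U i s -> exists2 a, arc_comp a = i & arc_set a s.
Proof.
move=> sU; exists (Arc (ex_intro2 _ _ s sU erefl)) => //.
by exists 0; rewrite addr0; exact: connected_component_refl.
Qed.

Lemma arc_eq a b s :
  arc_comp a = arc_comp b -> arc_set a s -> arc_set b s -> a = b.
Proof.
case: a b => [i A Ai] [j B Bj] /= ij; rewrite {}ij in Ai *.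
move=> As Bs; have AB : A = B.
  have [t tU At] := Ai; have [u uU Bu] := Bj; rewrite At Bu in As Bs *.
  by rewrite (arc_params_eq As) (arc_params_eq Bs).
by rewrite AB in Ai *; congr Arc; exact: Prop_irrelevance.
Qed.

End Diagram.

(** * Transport along a component *)

Lemma locally_constant_eq (R : realType) (T : Type) (f : R -> T) :
  (forall x, \forall y \near x, f y = f x) -> forall x y, f x = f y.
Proof.
move=> f_loc x y; pose B : set R := [set z | f z = f x].
have openB : open B.
  rewrite openE => z zx; rewrite /interior; near=> u.
  by rewrite /B /= -zx; near: u; exact: f_loc.
have closedB : closed B.
  rewrite -[B]setCK; apply: open_closedC; rewrite openE => z zx; near=> u => ux.
  by apply: zx; rewrite /B /= -ux; apply/esym; near: u; exact: f_loc.
have /connected_intervalP conn : is_interval [set: R] by [].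
have BT : B = setT.
  by apply: conn; [exists x | exists B; rewrite ?setTI..].
by have : B y by rewrite BT.
Unshelve. all: by end_near.
Qed.

Section Transport.
Variables (R : realType) (D : diagram R).
Local Notation n := (ncomp D).
Local Notation U := (@under_params R D).
Implicit Types (i j : 'I_n) (a b : arc D) (s t x y : R).
Implicit Types (c : point D * point D) (k : int).

Lemma not_under_near i x e : 0 < e ->
  exists2 y, x < y < x + e & ~ U i y.
Proof.
move=> e0; have [d d0 dU] := under_params_discrete i x.
have [m m0 [md me]] : exists2 m, 0 < m & m <= d /\ m <= e.
  by exists (Num.min d e); rewrite ?lt_min ?d0 // !ge_min !lexx orbT.
exists (x + m / 2) => [|xU]; first by lra.
by have := dU (x + m / 2) _ xU; lra.
Qed.

(** A quantity attached to the points of the arcs of a component is constant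
    if it changes neither between underpasses nor across one: it is then
    locally constant on the line, away from the underpasses.  The parameters
    live on the universal cover of the component, so [h] need not be
    periodic. *)
Lemma arc_transport (T : Type) i (h : arc D -> R -> T) :
  (forall a s t, arc_comp a = i -> arc_set a s -> s <= t ->
     (forall y, s <= y <= t -> ~ U i y) -> h a s = h a t) ->
  (forall c k a b s t, classical_crossings D c -> c.2.1 = i ->
     arc_comp a = i -> arc_comp b = i -> arc_set a s -> arc_set b t ->
     s < c.2.2 + k%:~R < t ->
     (forall y, s <= y <= t -> U i y -> y = c.2.2 + k%:~R) -> h a s = h b t) ->
  forall a b s t, arc_comp a = i -> arc_comp b = i ->
    arc_set a s -> arc_set b t -> h a s = h b t.
Proof.
move=> h_const h_cross.
have h_seg a b s t : arc_comp a = i -> arc_comp b = i -> arc_set a s ->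
    arc_set b t -> s <= t -> (forall y, s <= y <= t -> ~ U i y) ->
    h a s = h b t.
  move=> ai bi sa tb st stU; have ta : arc_set a t.
    by apply/(arc_set_segment (s := s)) => //; rewrite ai.
  by rewrite (h_const _ _ _ ai sa st stU) (arc_eq _ ta tb) // ai bi.
(* [eg] is a radius together with the common value near [x]. *)
pose locval x (eg : R * T) := 0 < eg.1 /\
  forall s a, x - eg.1 <= s <= x + eg.1 ->
  arc_comp a = i -> arc_set a s -> h a s = eg.2.
have /choice[eg egP] : forall x, exists eg, locval x eg.
  move=> x; have [e e0 eU] := under_params_discrete i x.
  have [xU|xU] := pselect (U i x).
    have [c [k [cc ci xE]]] := xU.
    (* The arcs on both sides of the underpass. *)
    have lU : ~ U i (x - e) by move=> /eU; lra.
    have rU : ~ U i (x + e) by move=> /eU; lra.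
    have [a ai la] := arc_exists lU; have [b bi rb] := arc_exists rU.
    have ab : h a (x - e) = h b (x + e).
      by apply: (h_cross c k) => //; rewrite -xE; [lra | exact: eU].
    exists (e, h a (x - e)); split=> //= s d sx di sd.
    have sU : ~ U i s by rewrite -di; exact: arc_not_under sd.
    have [sx'|xs|sx'] := ltgtP s x; last by rewrite sx' in sU.
      apply/esym/h_seg => //; first by lra.
      by move=> y yE /eU; lra.
    rewrite ab; apply: h_seg => //; first by lra.
    by move=> y yE /eU; lra.
  have [a ai xa] := arc_exists xU; exists (e, h a x); split=> //= s d sx di sd.
  have segU y : x - e <= y <= x + e -> ~ U i y.
    by move=> ye yU; apply: xU; rewrite -(eU y).
  have [sx'|xs] := leP s x.
    by apply: h_seg => // y ?; apply: segU; lra.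
  by apply/esym/h_seg => //; [lra | move=> y ?; apply: segU; lra].
have G_loc x : \forall y \near x, (eg y).2 = (eg x).2.
  have [ex0 exP] := egP x; near=> y; have [ey0 eyP] := egP y.
  have yx : x - (eg x).1 < y < x + (eg x).1.
    by near: y; apply: near_in_itvoo; rewrite in_itv /=; lra.
  pose d := x + (eg x).1 - y; have d0 : 0 < d by rewrite /d; lra.
  have [m m0 [m1 m2]] : exists2 m, 0 < m & m <= (eg y).1 /\ m <= d.
    exists (Num.min (eg y).1 d); last by rewrite !ge_min !lexx orbT.
    by rewrite lt_min ey0.
  rewrite /d in m2.
  have [s sy sU] := not_under_near i y m0; have [a ai sa] := arc_exists sU.
  by rewrite -(eyP s a) // -?(exP s a) //; lra.
move=> a b s t ai bi sa tb; have [es0 esP] := egP s; have [et0 etP] := egP t.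
rewrite (esP s a) //; last by lra.
by rewrite (etP t b) //; [exact: (locally_constant_eq G_loc) | lra].
Unshelve. all: by end_near.
Qed.

(** * Counting underpasses *)

(** On the lift of the [i]-th curve to the line, the [j]-th entry is a signed
    count of the passages under the [j]-th curve up to [s], normalized by a
    constant.  Each crossing recurs with period 1, so it contributes a floor. *)
Definition undercount i s : 'rV[int]_n :=
  \row_j \sum_(c \in over_crossings j i) writhe c * Num.floor (s - c.2.2).

(** One turn around the component adds its vector of linking numbers; the
    diagonal entry is the self-writhe. *)
Lemma undercountD i s k : undercount i (s + k%:~R) =
  undercount i s + k *: \row_j linking_number j i.
Proof.
apply/rowP => j; rewrite !mxE /linking_number !fsbig_finite;
  try exact: finite_over_crossings.
rewrite /= big_distrr -big_split; apply: eq_bigr => c _ /=.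
by rewrite addrAC floorDrz ?intrKfloor ?intr_int // mulrDr [k * _]mulrC.
Qed.

Lemma undercount_const i s t : s <= t ->
  (forall y, s <= y <= t -> ~ U i y) -> undercount i s = undercount i t.
Proof.
move=> st stU; apply/rowP => j; rewrite !mxE; apply: eq_fsbigr => c.
rewrite inE => -[cc _ ci]; congr (_ * _); apply: floor_const => [|k kst].
  by rewrite lerD2r.
by apply: (stU (c.2.2 + k%:~R)); [lra | exists c, k].
Qed.

Lemma undercount_jump c k s t : classical_crossings D c ->
  s < c.2.2 + k%:~R < t ->
  (forall y, s <= y <= t -> U c.2.1 y -> y = c.2.2 + k%:~R) ->
  undercount c.2.1 t = undercount c.2.1 s + writhe c *: delta_mx 0 c.1.1.
Proof.
move=> cc cst oneU; have fin j := finite_over_crossings j c.2.1.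
(* Among the crossings under this curve only [c] has an underpass between [s]
   and [t], so only its floor changes. *)
have jumpE j :
    \sum_(d \in over_crossings j c.2.1) (if d == c then writhe d else 0) =
    writhe c * (j == c.1.1)%:R.
  rewrite fsbig_finite; last exact: fin.
  have [->|jc] := eqVneq j c.1.1.
    rewrite (bigD1_seq c) ?finmap.fset_uniq ?in_fset_set ?inE //= eqxx mulr1.
    by rewrite big1 ?addr0 // => d /negPf->.
  rewrite mulr0 big1_seq // => d /andP[_].
  rewrite in_fset_set // inE => -[_ dj _].
  by case: eqVneq => // dc; rewrite dc in dj; rewrite dj eqxx in jc.
apply/rowP => j; rewrite !mxE eqxx /= -[X in _ = _ + X]jumpE.
rewrite !(fsbig_finite _ _ (fin _)).
rewrite -big_split; apply: eq_big_seq => d.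
rewrite in_fset_set // inE => -[dd _ di].
have [->|dc] := eqVneq d c.
  rewrite (@floor_jump _ (s - c.2.2) (t - c.2.2) k) ?mulrDr ?mulr1 //.
    by lra.
  move=> m mst; have /oneU : s <= c.2.2 + m%:~R <= t by lra.
  have mU : U c.2.1 (c.2.2 + m%:~R) by exists c, m.
  by move=> /(_ mU)/addrI/eqP; rewrite eqr_int => /eqP.
rewrite /= addr0 -(@floor_const _ (s - d.2.2) (t - d.2.2)) // => [|m mst].
  by lra.
have /oneU : s <= d.2.2 + m%:~R <= t by lra.
have mU : U c.2.1 (d.2.2 + m%:~R) by exists d, m.
move=> /(_ mU) dmck; move/eqP: dc; apply; apply: under_point_inj => //.
rewrite [LHS]surjective_pairing [RHS]surjective_pairing di; congr pair.
have [_ d01] := crossing_params dd; have [_ c01] := crossing_params cc.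
by apply: (eq_mod1 (k := k - m) d01 c01); rewrite intrB; lra.
Qed.

End Transport.

(** * A quandle of cosets *)

(** An element of the [j]-th orbit shifts the subsets of the other orbits by
    [e_j].  Taking all subsets avoids quotient groups, as cosets are particular
    subsets; their own shift is suppressed to make the operation idempotent. *)
Definition coset_quandle n : Type := ('I_n * set 'rV[int]_n)%type.

Section CosetQuandle.
Variable n : nat.
Implicit Types x y w : coset_quandle n.

Definition coset_op x y : coset_quandle n :=
  (x.1, if x.1 == y.1 then x.2 else [set v | x.2 (v - delta_mx 0 y.1)]).

Lemma coset_opxx x : coset_op x x = x.
Proof. by rewrite /coset_op eqxx -surjective_pairing. Qed.

Lemma coset_op_bij y : bijective (coset_op^~ y).
Proof.
exists (fun x => (x.1, if x.1 == y.1 then x.2 else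
  [set v | x.2 (v + delta_mx 0 y.1)])) => -[i S]; rewrite /coset_op /=;
  case: (i == y.1) => //; congr pair; apply/funext => v /=.
  by rewrite addrK.
by rewrite subrK.
Qed.

Lemma coset_op_tc w x y : coset_op (coset_op w x) y = coset_op (coset_op w y) x.
Proof.
rewrite /coset_op /=; case: (w.1 == y.1) => //; case: (w.1 == x.1) => //.
by congr pair; apply/funext => v /=; rewrite addrAC.
Qed.

Lemma coset_opDl w x y :
  coset_op (coset_op w x) y = coset_op (coset_op w y) (coset_op x y).
Proof. by rewrite coset_op_tc /coset_op. Qed.

HB.instance Definition _ := isQuandle.Build (coset_quandle n)
  coset_opxx coset_op_bij coset_opDl.

Lemma coset_quandle_tc : translation_commutative (coset_quandle n).
Proof. exact: coset_op_tc. Qed.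

Lemma coset_quandle_op (l : 'I_n -> 'I_n -> int) i j v T :
  ((i, coset l i v) : coset_quandle n) ▷ (j, T) =
  (i, coset l i (v + delta_mx 0 j)).
Proof.
rewrite [LHS]/(coset_op _ _) /coset_op /=; congr pair.
apply/predeqP => w; case: eqVneq => [->|ij].
  by split=> -[k kE]; exists k => m mj; have := kE m mj;
    rewrite !mxE eqxx /= (negPf (introN eqP mj)) addr0.
by split=> -[k kE]; exists k => m mi; have := kE m mi; rewrite !mxE; lra.
Qed.

End CosetQuandle.

(** * The link quandle *)

Section LinkQuandle.
Variables (R : realType) (D : diagram R).
Local Notation n := (ncomp D).
Local Notation U := (@under_params R D).
Local Notation lk := (@linking_number R D).
Implicit Types (i j : 'I_n) (a b : arc D) (s t x y : R).
Implicit Types (c : point D * point D) (k : int).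

Lemma arc_near_left i x a e : 0 < e -> arc_before (i, x) a ->
  exists2 s, x - e < s < x & arc_set a s.
Proof.
move=> e0 [_ xa]; suff : \forall s \near x^'-, x - e < s < x /\ arc_set a s.
  by move/filter_ex => [s [sx sa]]; exists s.
near=> s; split; last by near: s.
by apply/andP; split; near: s; [apply: nbhs_left_gt; lra | exact: nbhs_left_lt].
Unshelve. all: by end_near.
Qed.

Lemma arc_near_right i x a e : 0 < e -> arc_after (i, x) a ->
  exists2 s, x < s < x + e & arc_set a s.
Proof.
move=> e0 [_ xa]; suff : \forall s \near x^'+, x < s < x + e /\ arc_set a s.
  by move/filter_ex => [s [sx sa]]; exists s.
near=> s; split; last by near: s.
apply/andP; split; near: s; first exact: nbhs_right_gt.
by apply: nbhs_right_lt; lra.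
Unshelve. all: by end_near.
Qed.

(** An arc adjacent to an underpass contains points arbitrarily near to it, so
    the two sides can be compared across this underpass only. *)
Lemma undercount_crossing c a b : classical_crossings D c ->
  arc_before c.2 a -> arc_after c.2 b ->
  exists s t, [/\ arc_set a s, arc_set b t &
    undercount c.2.1 t = undercount c.2.1 s + writhe c *: delta_mx 0 c.1.1].
Proof.
move=> cc; rewrite [c.2]surjective_pairing => ca cb.
have [e e0 eU] := under_params_discrete c.2.1 c.2.2.
have [s sE sa] := arc_near_left e0 ca; have [t tE tb] := arc_near_right e0 cb.
exists s, t; split=> //; apply: (@undercount_jump _ _ c 0 s t cc).
  by rewrite addr0; lra.
by move=> y yE yU; rewrite addr0; apply: eU => //; lra.
Qed.

Lemma arc_beforeP c k a s : classical_crossings D c -> arc_comp a = c.2.1 ->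
  arc_set a s -> s < c.2.2 + k%:~R ->
  (forall y, s <= y -> U c.2.1 y -> c.2.2 + k%:~R <= y) -> arc_before c.2 a.
Proof.
move=> cc ac sa sx xU; split=> //; near=> t.
have ts : s - k%:~R <= t by near: t; apply: nbhs_left_ge; lra.
have tx : t < c.2.2 by near: t; exact: nbhs_left_lt.
rewrite -[t](addrK k%:~R) -intrN; apply: arc_setD.
apply/(arc_set_segment (s := s)) => //; first by lra.
by rewrite ac => y yE /xU; lra.
Unshelve. all: by end_near.
Qed.

Lemma arc_afterP c k a s : classical_crossings D c -> arc_comp a = c.2.1 ->
  arc_set a s -> c.2.2 + k%:~R < s ->
  (forall y, y <= s -> U c.2.1 y -> y <= c.2.2 + k%:~R) -> arc_after c.2 a.
Proof.
move=> cc ac sa sx xU; split=> //; near=> t.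
have ts : t <= s - k%:~R by near: t; apply: nbhs_right_le; lra.
have tx : c.2.2 < t by near: t; exact: nbhs_right_gt.
rewrite -[t](addrK k%:~R) -intrN; apply: arc_setD.
apply/(arc_set_segment (t := s)) => //; first by lra.
by rewrite ac => y yE /xU; lra.
Unshelve. all: by end_near.
Qed.

(** Two parameters of an arc agree up to a whole number of turns and an
    interval without underpasses. *)
Lemma undercount_arc a s t : arc_set a s -> arc_set a t ->
  coset lk (arc_comp a) (undercount (arc_comp a) s) =
  coset lk (arc_comp a) (undercount (arc_comp a) t).
Proof.
move=> sa /(arc_setE _ sa)[k st].
have {st} : undercount (arc_comp a) s = undercount (arc_comp a) (t + k%:~R).
  have [st'|/ltW ts] := leP s (t + k%:~R).
    by apply: undercount_const => //; exact/component_segment.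
  apply/esym/undercount_const => //.
  by apply/component_segment => //; exact: connected_component_sym.
rewrite undercountD => ->; apply/predeqP => w; split=> -[m mE].
  exists (m + k) => j ji; rewrite mulrDl -mE // !mxE; lra.
exists (m - k) => j ji; rewrite mulrBl -mE // !mxE; lra.
Qed.

Local Notation Q := (tc_quotient (link_quandle D)).

Definition arc_gen a : Q := tc_proj (pgen (@link_rel R D) a).

Lemma arc_gen_crossing c a1 a2 a3 : classical_crossings D c ->
  passes a1 c.1 -> right_arc c a2 -> left_arc c a3 ->
  arc_gen a3 = arc_gen a2 ▷ arc_gen a1.
Proof.
move=> cc ca1 ca2 ca3; rewrite /arc_gen -tc_projM /pgen; congr tc_proj.
rewrite pclassM; apply/pclassP/qcongr_rel.
exact: link_rel_crossing ca3.
Qed.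

Lemma writhe_cases c : (writhe c = 1) \/ (writhe c = -1).
Proof. by rewrite /writhe; case: ifP; [left | right]. Qed.

Lemma arc_gen_under c a b : classical_crossings D c ->
  arc_before c.2 a -> arc_after c.2 b ->
  exists2 d, arc_comp d = c.1.1 &
    (writhe c = 1 /\ arc_gen b = arc_gen a ▷ arc_gen d) \/
    (writhe c = -1 /\ arc_gen a = arc_gen b ▷ arc_gen d).
Proof.
move=> cc ca cb; have [d dc dp] := arc_exists (over_point_not_under cc).
exists d => //; have [w1|w1] := writhe_cases c; [left|right]; split=> //;
  by apply: (arc_gen_crossing cc) => //; rewrite /right_arc /left_arc w1.
Qed.

Lemma arc_inhabited a : exists s, arc_set a s.
Proof.
have [t tU ->] := arcP a; exists t.
by exists 0; rewrite addr0; exact: connected_component_refl.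
Qed.

(** The morphism sends an arc to the class of its undercount.  The jump of the
    undercount at a crossing is what the crossing relation requires.  It
    separates elements with different coordinates. *)
Lemma link_quandle_hom : exists2 F : Q -> coset_quandle n,
  quandle_morphism F & forall a s, arc_set a s ->
    F (arc_gen a) =
    (arc_comp a, coset lk (arc_comp a) (undercount (arc_comp a) s)).
Proof.
have /choice[p pa] := arc_inhabited.
pose h a : coset_quandle n :=
  (arc_comp a, coset lk (arc_comp a) (undercount (arc_comp a) (p a))).
have hE a s : arc_set a s ->
    h a = (arc_comp a, coset lk (arc_comp a) (undercount (arc_comp a) s)).
  by move=> sa; rewrite /h (undercount_arc (pa a) sa).
have [f fM fE] : exists2 f : link_quandle D -> coset_quandle n,
    quandle_morphism f & forall a, f (pgen _ a) = h a.
  apply: presented_lift => _ _ [c a1 a2 a3 cc [ca1 _]] /= ca2 ca3.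
  move: ca2 ca3; rewrite /right_arc /left_arc.
  have [w1|w1] := writhe_cases c; rewrite w1 /= => ca2 ca3.
    have [s [t [sa tb]]] := undercount_crossing cc ca2 ca3.
    have [[a2c _] [a3c _]] := (ca2, ca3).
    rewrite (hE _ _ sa) (hE _ _ tb) a2c a3c coset_quandle_op ca1 w1.
    by rewrite scale1r => ->.
  have [s [t [sa tb]]] := undercount_crossing cc ca3 ca2.
  have [[a2c _] [a3c _]] := (ca2, ca3).
  rewrite (hE _ _ sa) (hE _ _ tb) a2c a3c coset_quandle_op ca1 w1.
  by rewrite scaleN1r => ->; rewrite subrK.
have [F FM FE] := tc_quotient_lift (@coset_quandle_tc n) fM.
by exists F => // a s sa; rewrite FE fE (hE _ _ sa).
Qed.

(** The base point [g i] is the element of any arc of the [i]-th component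
    moved back by the undercount; [arc_transport] makes it independent of the
    arc and of the turn, and the latter says that the vector of linking numbers
    fixes it. *)
Lemma tc_link_coordinates :
  exists pt : 'I_n -> 'rV[int]_n -> Q, coordinates lk pt.
Proof.
have tcQ := @tc_quotient_tc (link_quandle D).
have /choice[base /choice[p baseP]] : forall i, exists a s,
    arc_comp a = i /\ arc_set a s.
  move=> i; have [s _ sU] := not_under_near i 0 ltr01.
  by have [a ai sa] := arc_exists sU; exists a, s.
have adjacent c k a b s t : classical_crossings D c ->
    arc_comp a = c.2.1 -> arc_comp b = c.2.1 -> arc_set a s -> arc_set b t ->
    s < c.2.2 + k%:~R < t ->
    (forall y, s <= y <= t -> U c.2.1 y -> y = c.2.2 + k%:~R) ->
    arc_before c.2 a /\ arc_after c.2 b.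
  move=> cc ac bc sa tb /andP[sx xt] oneU; split.
    apply: (arc_beforeP cc ac sa sx) => y sy yU.
    rewrite leNgt; apply/negP => yx.
    by have := oneU y _ yU; lra.
  apply: (arc_afterP cc bc tb xt) => y yt yU; rewrite leNgt; apply/negP => yx.
  by have := oneU y _ yU; lra.
(* The translation by an arc depends only on its component: this must come
   before the action, which is built from one arc of each component. *)
have base_op a (z : Q) : z ▷ arc_gen a = z ▷ arc_gen (base (arc_comp a)).
  have [s sa] := arc_inhabited a; have [ba pa] := baseP (arc_comp a).
  apply: (@arc_transport _ _ _ (arc_comp a)
    (fun a _ => z ▷ arc_gen a)) sa pa => //.
  move=> c k d b {}s t cc <- dc bc sd tb cst oneU.
  have [cd cb] := adjacent _ _ _ _ _ _ cc dc bc sd tb cst oneU.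
  have tcop := tc_qop_qop tcQ.
  by have [e _ [[_ ->]|[_ ->]]] := arc_gen_under cc cd cb; rewrite tcop.
pose act := qact (fun i => arc_gen (base i)).
have act_arc a z : act (delta_mx 0 (arc_comp a)) z = z ▷ arc_gen a.
  by rewrite /act qact_delta -base_op.
have actD v w z : act (v + w) z = act v (act w z) by exact: qactD.
have actZ v k z : act v z = z -> act (k *: v) z = z by exact: qact_fixZ.
have actK v : cancel (act v) (act (- v)) by exact: qactK.
have actVK v : cancel (act (- v)) (act v) by exact: qactVK.
pose g i := act (- undercount i (p i)) (arc_gen (base i)).
have gE a s : arc_set a s ->
    arc_gen a = act (undercount (arc_comp a) s) (g (arc_comp a)).
  move=> sa; rewrite -[LHS](actVK (undercount (arc_comp a) s)); congr act.
  have [ba pa] := baseP (arc_comp a).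
  apply: (@arc_transport _ _ _ (arc_comp a)
    (fun b s => act (- undercount (arc_comp a) s) (arc_gen b))) sa pa => //.
    move=> d {}s t di sd st stU; congr (act (- _) _).
    exact: undercount_const.
  move=> c k d b {}s t cc <- dc bc sd tb cst oneU.
  have [cd cb] := adjacent _ _ _ _ _ _ cc dc bc sd tb cst oneU.
  rewrite (undercount_jump cc cst oneU).
  have [e <- [[-> ->]|[-> ->]]] := arc_gen_under cc cd cb.
    by rewrite -act_arc -actD scale1r opprD subrK.
  by rewrite -act_arc -actD scaleN1r opprB addrC.
pose pt i v := act v (g i); exists pt.
have op_pt i v j w : pt i v ▷ pt j w = pt i (v + delta_mx 0 j).
  rewrite /pt /g /act !qop_qact // addrC qactD //.
  by rewrite qact_delta.
have act_delta_g i : act (delta_mx 0 i) (g i) = g i.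
  by have := op_pt i 0 i 0; rewrite qopxx add0r /pt /act qact0.
have act_lk_g i : act (\row_j lk j i) (g i) = g i.
  have [bi pi] := baseP i.
  have := gE _ _ (arc_setD 1 pi).
  rewrite (gE _ _ pi) bi undercountD scale1r actD.
  by move/(can_inj (actK _)).
have arc_pt a s : arc_set a s ->
    arc_gen a = pt (arc_comp a) (undercount (arc_comp a) s).
  exact: gE.
split=> // [z|i j v w].
  have [q ->] := tc_proj_surj z; elim/presented_ind: q => [a|q q'|q q'].
  - have [s sa] := arc_inhabited a.
    by exists (arc_comp a), (undercount (arc_comp a) s); exact: arc_pt.
  - move=> [i [v qE]] [j [w q'E]]; exists i, (v + delta_mx 0 j).
    by rewrite tc_projM qE q'E op_pt.
  move=> [i [v qE]] [j [w q'E]]; exists i, (v - delta_mx 0 j).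
  apply: (@qop_inj _ (tc_proj q')); rewrite -tc_projM qE q'E op_pt subrK //.
(* Different classes are told apart by their images among the cosets, equal
   classes differ by multiples of vectors that fix the base point. *)
split=> [vw|[<- [k kE]]].
  have [F FM FE] := link_quandle_hom.
  have F1 i' v' : (F (pt i' v')).1 = i'.
    have [bi pi] := baseP i'.
    apply: (@rV_int_ind _ (fun v => (F (pt i' v)).1 = i')
      (undercount i' (p i'))).
      rewrite -[X in pt X _]bi -[X in undercount X _]bi -arc_pt //.
      by rewrite (FE _ _ pi).
    by move=> u m; rewrite -(op_pt _ _ m 0) FM.
  have F2 i' v' : F (pt i' v') = (i', coset lk i' v').
    have [bi pi] := baseP i'.
    apply: (@rV_int_ind _ (fun v => F (pt i' v) = (i', coset lk i' v))
      (undercount i' (p i'))).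
      rewrite -[X in pt X _]bi -[X in undercount X _]bi -arc_pt //.
      by rewrite (FE _ _ pi) bi.
    move=> u m; rewrite -(op_pt _ _ m 0) FM.
    rewrite -(coset_quandle_op _ _ _ _ (F (pt m 0)).2) -[X in (X, _.2)](F1 m 0).
    rewrite -surjective_pairing; split=> [->//|]; exact: qop_inj.
  have := congr1 F vw; rewrite !F2 => -[ij vwE]; split=> //; rewrite ij -vwE.
  by exists 0 => m _; rewrite mul0r subrr.
have -> : v = w + k *: (\row_j lk j i) +
    (v 0 i - w 0 i - k * lk i i) *: delta_mx 0 i.
  apply/rowP => m; rewrite !mxE eqxx /=; have [->|/eqP mi] := eqVneq m i.
    by rewrite mulr1; lra.
  by rewrite mulr0; have := kE m mi; lra.
by rewrite /pt !actD !actZ.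
Qed.

End LinkQuandle.

Theorem theorem6 (R : realType) (D D' : diagram R) :
  quandle_isomorphic (tc_quotient (link_quandle D))
                     (tc_quotient (link_quandle D')) <->
  (ncomp D = ncomp D' /\
   exists (mu : nat) (K : 'I_mu -> 'I_(ncomp D)) (K' : 'I_mu -> 'I_(ncomp D'))
          (eps : 'I_mu -> int),
     [/\ bijective K, bijective K',
         forall i, eps i \in [:: -1; 1] &
         forall i j, i <> j ->
           linking_number (K j) (K i) =
             eps i * linking_number (K' j) (K' i)]).
Proof.
have [pt ptP] := tc_link_coordinates D.
have [pt' ptP'] := tc_link_coordinates D'.
rewrite (isomorphic_coordinates ptP ptP').
split=> [[s [eps [s_bij epsE] lkE]]|].
  split; first by have := bij_eq_card s_bij; rewrite !card_ord.
  by exists (ncomp D), id, s, eps; split=> //; exists id.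
move=> [_ [mu [K [K' [eps [[t Kt tK] K'_bij epsE lkE]]]]]].
exists (K' \o t), (eps \o t); first split.
- by apply: bij_comp => //; exists K.
- by move=> i; exact: epsE.
move=> i j ij; rewrite -[in LHS](tK i) -[in LHS](tK j) lkE //.
by move/(can_inj tK).
Qed.
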